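(* Suppose that the algebra $A(\xi)$ is such that $\alpha=\nu=1$ and $\beta=0$ (so $\chi_1^r=\epsilon$, $\chi_1\chi_2=\epsilon$ and $r=s$). Let $\eta\in F(\xi)$ and let $W(\eta)$ be the $B(\xi)$-module with basis $f_0,\dots,f_{r-1}$, subscripts taken modulo $r$. Set $c_0=0$ and define scalars $(c_i)_{0<i\le r}$ recursively by $$c_i=q\left(c_{i-1}-\nu\left((\eta\chi_1^{i-1})(g_1g_2)-1\right)\right)=q\left(c_{i-1}+\nu-\nu q^{2(i-1)}\eta(g_1g_2)\right).$$ Define an operator $y$ on $W(\eta)$ by $y.f_i=c_if_{i-1}$. Then this (together with the given action of $x$ and of $\Gamma$ on $W(\eta)$) defines a representation of $A(\xi)$; denote this $A(\xi)$-module by $L(\eta)$. Then $L(\eta)$ is irreducible; every irreducible $A(\xi)$-module is isomorphic to $L(\eta)$ for some $\eta\in F(\xi)$; and, for $\eta,\eta'\in F(\xi)$, if $L(\eta)\simeq L(\eta')$ then $\eta=\eta'\chi_1^m$ for some integer $m$.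
   Context: Let $k$ be an algebraically closed field of characteristic $0$, $\Gamma$ a finite abelian group, $\widehat{\Gamma}$ its group of characters $\Gamma\to k^\times$, with trivial character $\epsilon$. Let $g_1,g_2\in\Gamma$ and $\chi_1,\chi_2\in\widehat\Gamma$ with $\chi_1(g_2)\chi_2(g_1)=1$. Let $r>1$ be the order of $q:=\chi_1(g_1)$ and $s>1$ the order of $\chi_2(g_2)$. Let $\alpha_{11},\alpha_{22},\nu\in k$ be scalars such that: $\alpha_{11}=0$ if $g_1^r=1$ or $\chi_1^r\neq\epsilon$; $\alpha_{22}=0$ if $g_2^s=1$ or $\chi_2^s\ne\epsilon$; $\nu=0$ if $g_1g_2=1$ or $\chi_1\chi_2\neq\epsilon$. The lifting $A$ of the quantum plane is the pointed Hopf algebra (of dimension $|\Gamma|rs$) generated by the elements $h\in\Gamma$ (with the relations of the group $\Gamma$) and $x,y$, with relations $hx=\chi_1(h)xh$, $hy=\chi_2(h)yh$ ($h\in\Gamma$), $x^r=\alpha_{11}(g_1^r-1)$, $y^s=\alpha_{22}(g_2^s-1)$, $xy=\chi_2(g_1)yx+\nu(g_1g_2-1)$. Let $\Lambda=\{g\in\Gamma:\chi_1(g)=\chi_2(g)=1\}$, a subgroup of $\Gamma$ that is central in $A$. If $\alpha_{11}\ne0$ then $g_1^r\in\Lambda$, and if $\alpha_{22}\neq 0$ then $g_2^s\in\Lambda$. Fix $\xi\in\widehat\Lambda$ and put $\alpha=\alpha_{11}(\xi(g_1^r)-1)$ and $\beta=\alpha_{22}(\xi(g_2^s)-1)$ (understood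 to be $0$ when $\alpha_{11}=0$, resp. $\alpha_{22}=0$). The algebra $A(\xi)$ is the quotient of $A$ by the relations $g=\xi(g)1$ for $g\in\Lambda$; that is, it is generated by $x$, $y$ and $h\in\Gamma$ with the relations of $\Gamma$ and $g=\xi(g)$ ($g\in\Lambda$), $hx=\chi_1(h)xh$, $hy=\chi_2(h)yh$ ($h\in\Gamma$), $x^r=\alpha$, $y^s=\beta$, $xy=\chi_2(g_1)yx+\nu(g_1g_2-1)$. Let $F(\xi)=\{\eta\in\widehat\Gamma:\eta|_\Lambda=\xi\}$. When $\chi_1\chi_2=\epsilon$ one has $q=\chi_1(g_1)=\chi_1(g_2)=\chi_2(g_1)^{-1}=\chi_2(g_2)^{-1}$, hence $r=s$. When $\alpha=1$ (so that $\chi_1^r=\epsilon$ and $\chi_1$ has order $r$), let $B(\xi)$ be the algebra generated by $x$ and $h\in\Gamma$ with the relations of $\Gamma$ and $g=\xi(g)$ ($g\in\Lambda$), $hx=\chi_1(h)xh$ ($h\in\Gamma$), $x^r=1$. For $\eta\in F(\xi)$, $W(\eta)$ is the $B(\xi)$-module with basis $f_i$, $i\in\mathbf{Z}/r$, and action $x.f_i=f_{i+1}$, $h.f_i=(\chi_1^i\eta)(h)f_i$ for $h\in\Gamma$ (so $x.f_{r-1}=f_0$). The scalars $c_i$ defined by the recursion in the claim depend only on $i$ modulo $r$. *)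

(* Defs.v *)
From HB Require Import structures.
From mathcomp Require Import all_boot all_order all_fingroup all_algebra.
From mathcomp Require Import monalg boolp generic_quotient.

Set Implicit Arguments.
Unset Strict Implicit.
Unset Printing Implicit Defensive.

Import GRing.Theory.
Local Open Scope ring_scope.
Local Open Scope quotient_scope.

Notation free_algebra k X := {malg k[{fmonom X}]}.

Section PresentedAlgebra.
Variables (k : fieldType) (X : choiceType).
Local Notation freeAlg := (free_algebra k X).

Definition fgen (x : X) : freeAlg := << fmu x >>.
Definition fscal (c : k) : freeAlg := c%:MP.

Definition two_sided_ideal (I : freeAlg -> Prop) : Prop :=
  [/\ I 0, forall a b, I a -> I b -> I (a - b)
     & forall a b c, I b -> I (a * b * c)].

(* Members of rel are the elements set to 0, so u = v is encoded as u - v. *)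
Variable rel : freeAlg -> Prop.

Definition ideal_gen : {pred freeAlg} := fun a =>
  `[< forall I, two_sided_ideal I -> (forall b, rel b -> I b) -> I a >].

Lemma ideal_genP : two_sided_ideal ideal_gen.
Proof.
split.
- by apply/asboolP => I [].
- move=> a b /asboolP Ia /asboolP Ib; apply/asboolP => I idI relI.
  by case: (idI) => _ subI _; apply: subI; [apply: Ia | apply: Ib].
- move=> a b c /asboolP Ib; apply/asboolP => I idI relI.
  by case: (idI) => _ _ mulI; apply: mulI; apply: Ib.
Qed.

Lemma ideal_gen_zmod_closed : zmod_closed ideal_gen.
Proof. by case: ideal_genP. Qed.
HB.instance Definition _ :=
  GRing.isZmodClosed.Build freeAlg ideal_gen ideal_gen_zmod_closed.

(* The quotient may be zero, hence only a pzRingType: MathComp's algType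
   requires 1 != 0. *)
Definition presAlg : Type := Quotient.quot ideal_gen.
HB.instance Definition _ := GRing.Zmodule.on presAlg.
HB.instance Definition _ := EqQuotient.on presAlg.

Definition pres_one : presAlg := lift_cst presAlg 1.
Definition pres_mul : presAlg -> presAlg -> presAlg := lift_op2 presAlg *%R.
Canonical pi_pres_one_morph := PiConst pres_one.

Lemma pi_pres_mul : {morph \pi_presAlg : a b / a * b >-> pres_mul a b}.
Proof.
have [_ _ idM] := ideal_genP.
move=> a b; unlock pres_mul; apply/eqP.
rewrite -[_ == _]/(\pi_(Quotient.quot ideal_gen) _ == \pi_(Quotient.quot _) _).
rewrite eqmodE /= /Quotient.equiv.
have Da : a - repr (\pi_presAlg a) \in ideal_gen.
  by rewrite Quotient.idealrBE; apply/eqP; rewrite reprK.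
have Db : b - repr (\pi_presAlg b) \in ideal_gen.
  by rewrite Quotient.idealrBE; apply/eqP; rewrite reprK.
rewrite -(subrKA (repr (\pi_presAlg a) * b)) -mulrBl -mulrBr rpredD //.
  by rewrite -[_ * b]mul1r mulrA; apply: idM.
by rewrite -[_ * (b - _)]mulr1; apply: idM.
Qed.
Canonical pi_pres_mul_morph := PiMorph2 pi_pres_mul.

Lemma pres_mulA : associative pres_mul.
Proof. by move=> a b c; rewrite -[a]reprK -[b]reprK -[c]reprK !piE mulrA. Qed.
Lemma pres_mul1 : left_id pres_one pres_mul.
Proof. by move=> a; rewrite -[a]reprK !piE mul1r. Qed.
Lemma pres_mulr1 : right_id pres_one pres_mul.
Proof. by move=> a; rewrite -[a]reprK !piE mulr1. Qed.

Lemma pres_piD (a b : freeAlg) :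
  \pi_presAlg (a + b) = \pi_presAlg a + \pi_presAlg b.
Proof. exact: (raddfD \pi_(Quotient.quot ideal_gen)). Qed.

Lemma pres_mulDl : left_distributive pres_mul +%R.
Proof.
move=> a b c; rewrite -[a]reprK -[b]reprK -[c]reprK.
by rewrite -pres_piD -!pi_pres_mul -pres_piD mulrDl.
Qed.
Lemma pres_mulDr : right_distributive pres_mul +%R.
Proof.
move=> a b c; rewrite -[a]reprK -[b]reprK -[c]reprK.
by rewrite -pres_piD -!pi_pres_mul -pres_piD mulrDr.
Qed.

HB.instance Definition _ := GRing.Zmodule_isPzRing.Build presAlg
  pres_mulA pres_mul1 pres_mulr1 pres_mulDl pres_mulDr.

Definition pgen (x : X) : presAlg := \pi_presAlg (fgen x).
Definition pscal (c : k) : presAlg := \pi_presAlg (fscal c).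

Record representation (V : lmodType k) := Representation {
  ract :> presAlg -> V -> V;
  ractDr : forall a u v, ract a (u + v) = ract a u + ract a v;
  ractDl : forall a b v, ract (a + b) v = ract a v + ract b v;
  ract1 : forall v, ract 1 v = v;
  ractM : forall a b v, ract (a * b) v = ract a (ract b v);
  ractC : forall c v, ract (pscal c) v = c *: v
}.

Definition rep_module (V : lmodType k) (rho : representation V) : Type := V.

Section RepModule.
Variables (V : lmodType k) (rho : representation V).

HB.instance Definition _ := GRing.Zmodule.copy (rep_module rho) V.

Fact rep_scalerA (a b : presAlg) (v : rep_module rho) :
  rho a (rho b v) = rho (a * b) v.
Proof. by rewrite ractM. Qed.

HB.instance Definition _ := GRing.Zmodule_isLmodule.Build presAlg
  (rep_module rho) rep_scalerA (ract1 rho) (ractDr rho)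
  (fun v a b => ractDl rho a b v).

End RepModule.

End PresentedAlgebra.

Definition irreducible_module (A : pzRingType) (M : lmodType A) : Prop :=
  (exists v : M, v != 0) /\
  forall S : {pred M}, GRing.submod_closed S -> S =i pred1 0 \/ S =i predT.

Definition module_iso (A : pzRingType) (M N : lmodType A) : Prop :=
  exists f : {linear M -> N}, bijective f.

Definition is_character (k : fieldType) (gT : finGroupType) (H : {set gT})
    (chi : gT -> k) : Prop :=
  {in H, forall h, chi h != 0} /\
  {in H &, {morph chi : g h / (g * h)%g >-> g * h}}.

Record quantum_plane_datum (k : fieldType) (gT : finGroupType) := QPDatum {
  g1 : gT;
  g2 : gT;
  chi1 : gT -> k;
  chi2 : gT -> k;
  chi1P : is_character [set: gT] chi1;
  chi2P : is_character [set: gT] chi2;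
  chi_cross : chi1 g2 * chi2 g1 = 1;
  ord_r : nat;
  ord_s : nat;
  r_gt1 : (1 < ord_r)%N;
  s_gt1 : (1 < ord_s)%N;
  r_order : ord_r.-primitive_root (chi1 g1);
  s_order : ord_s.-primitive_root (chi2 g2);
  alpha11 : k;
  alpha22 : k;
  nu : k;
  alpha11P : (g1 ^+ ord_r)%g = 1%g \/ ~ (forall h, chi1 h ^+ ord_r = 1) ->
    alpha11 = 0;
  alpha22P : (g2 ^+ ord_s)%g = 1%g \/ ~ (forall h, chi2 h ^+ ord_s = 1) ->
    alpha22 = 0;
  nuP : (g1 * g2)%g = 1%g \/ ~ (forall h, chi1 h * chi2 h = 1) -> nu = 0
}.

Section Lifting.
Variables (k : fieldType) (gT : finGroupType) (D : quantum_plane_datum k gT).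

Notation g1 := (g1 D).
Notation g2 := (g2 D).
Notation chi1 := (chi1 D).
Notation chi2 := (chi2 D).
Notation r := (ord_r D).
Notation s := (ord_s D).
Notation nu := (nu D).

Definition Lambda : {set gT} := [set g | (chi1 g == 1) && (chi2 g == 1)].

(* A character of Lambda is a function on the whole group of which only the
   values on Lambda matter: g1 ^+ r lies in Lambda unless alpha11 = 0. *)
Variable xi : gT -> k.

Definition alpha : k := alpha11 D * (xi (g1 ^+ r)%g - 1).
Definition beta : k := alpha22 D * (xi (g2 ^+ s)%g - 1).

Definition gens : choiceType := (gT + bool)%type.
Definition genH (h : gT) : gens := inl h.
Definition genX : gens := inr false.
Definition genY : gens := inr true.

Notation fH h := (fgen k (genH h)).
Notation fX := (fgen k genX).
Notation fY := (fgen k genY).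

Inductive Axi_rel : free_algebra k gens -> Prop :=
| Axi_one : Axi_rel (fH 1%g - 1)
| Axi_mul g h : Axi_rel (fH g * fH h - fH (g * h)%g)
| Axi_Lambda g : g \in Lambda -> Axi_rel (fH g - fscal _ (xi g))
| Axi_hx h : Axi_rel (fH h * fX - chi1 h *: (fX * fH h))
| Axi_hy h : Axi_rel (fH h * fY - chi2 h *: (fY * fH h))
| Axi_xr : Axi_rel (fX ^+ r - fscal _ alpha)
| Axi_ys : Axi_rel (fY ^+ s - fscal _ beta)
| Axi_xy : Axi_rel
    (fX * fY - (chi2 g1 *: (fY * fX) + nu *: (fH (g1 * g2)%g - 1))).

Definition Axi : pzRingType := presAlg Axi_rel.
Definition Ax : Axi := pgen Axi_rel genX.
Definition Ay : Axi := pgen Axi_rel genY.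
Definition Ah (h : gT) : Axi := pgen Axi_rel (genH h).

Record fiber := Fiber {
  fiber_char :> gT -> k;
  fiber_charP : is_character [set: gT] fiber_char;
  fiber_res : {in Lambda, fiber_char =1 xi}
}.

Fixpoint coef (eta : gT -> k) (i : nat) : k :=
  if i is j.+1 then
    chi1 g1 *
      (coef eta j - nu * (eta (g1 * g2)%g * chi1 (g1 * g2)%g ^+ j - 1))
  else 0.

Definition W : lmodType k := 'rV[k]_r.
Definition Wbase (i : 'I_r) : W := delta_mx 0 i.

(* ordS and ord_pred are the cyclic successor and predecessor on 'I_r. *)
Definition L_action (eta : gT -> k) (rho : representation Axi_rel W) : Prop :=
  [/\ forall i, rho Ax (Wbase i) = Wbase (ordS i),
      forall h i, rho (Ah h) (Wbase i) = (chi1 h ^+ i * eta h) *: Wbase i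
    & forall i, rho Ay (Wbase i) = coef eta i *: Wbase (ord_pred i)].

End Lifting.

(* Main.v *)
(* The scalars satisfy (1 - q) c_i = (1 - q^i)(q - eta(g1 g2) q^i), so c_r = 0 and
   the c_i are periodic; hence L(eta) satisfies the relations.  L(eta) is
   irreducible because its weights chi1^i eta are separated by g1 and x permutes
   the weight lines transitively.  In an irreducible module M, y is nilpotent and
   its kernel is stable under the abelian group Gamma, hence contains a common
   eigenvector w, of weight eta say.  Since y x = q (x y - (g1 g2 - 1)), induction
   gives y x^(i+1) w = c_(i+1) x^i w, so f_i |-> x^i w is a nonzero homomorphism
   L(eta) -> M, an isomorphism by Schur's lemma. *)

Require Import Defs.
From HB Require Import structures.
From mathcomp Require Import all_boot all_order all_algebra all_fingroup.
From mathcomp Require Import finmap monalg boolp ring.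

Set Implicit Arguments.
Unset Strict Implicit.
Unset Printing Implicit Defensive.

Import GRing.Theory.
Local Open Scope ring_scope.

(** * Modules over presented algebras *)

Section FreeAlgebraAction.
Variables (k : fieldType) (X : choiceType) (V : lmodType k).
Variable T : X -> {linear V -> V}.
Local Notation freeAlg := (free_algebra k X).

Definition word_act (w : seq X) (v : V) : V := foldr (fun x => T x) v w.

Lemma word_act_linear w : linear (word_act w).
Proof. by elim: w => [|x w IHw] c u v //=; rewrite IHw linearP. Qed.
HB.instance Definition _ w :=
  GRing.isLinear.Build k V V _ (word_act w) (word_act_linear w).

Definition free_act (a : freeAlg) (v : V) : V :=
  \sum_(m <- msupp a) a@_m *: word_act m v.

(** Enlarging the index set adds only zero terms; this lets two elements be summed over one common
    set of words. *)
Lemma free_actEw (d : {fset {fmonom X}}) a v : (msupp a `<=` d)%fset ->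
  free_act a v = \sum_(m <- d) a@_m *: word_act m v.
Proof.
move=> le_ad; rewrite /free_act (big_fset_incl _ le_ad) //= => m _.
by move=> /mcoeff_outdom ->; rewrite scale0r.
Qed.

Lemma free_act_linear a : linear (free_act a).
Proof.
move=> c u v; rewrite /free_act scaler_sumr -big_split /=.
by apply: eq_bigr => m _; rewrite linearP scalerDr !scalerA mulrC.
Qed.
HB.instance Definition _ a :=
  GRing.isLinear.Build k V V _ (free_act a) (free_act_linear a).

Lemma free_actD a b v : free_act (a + b) v = free_act a v + free_act b v.
Proof.
pose d := (msupp a `|` msupp b)%fset.
rewrite !(@free_actEw d) ?fsubsetUl ?fsubsetUr ?msuppD_le //.
by rewrite -big_split /=; apply: eq_bigr => m _; rewrite mcoeffD scalerDl.
Qed.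

Lemma free_actZ c a v : free_act (c *: a) v = c *: free_act a v.
Proof.
rewrite (free_actEw v (msuppZ_le c a)) scaler_sumr.
by apply: eq_bigr => m _; rewrite mcoeffZ scalerA.
Qed.

Lemma free_actN a v : free_act (- a) v = - free_act a v.
Proof. by rewrite -[- a]scaleN1r free_actZ scaleN1r. Qed.

Lemma free_actB a b v : free_act (a - b) v = free_act a v - free_act b v.
Proof. by rewrite free_actD free_actN. Qed.

Lemma free_act0 v : free_act 0 v = 0.
Proof. by rewrite -(scale0r 0) free_actZ scale0r. Qed.

Lemma free_act_sum (I : Type) (s : seq I) (F : I -> freeAlg) v :
  free_act (\sum_(i <- s) F i) v = \sum_(i <- s) free_act (F i) v.
Proof.
by apply: (big_morph (free_act^~ v) (fun a b => free_actD a b v) (free_act0 v)).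
Qed.

Lemma free_actU c m v : free_act << c *g m >> v = c *: word_act m v.
Proof. by rewrite (free_actEw v msuppU_le) big_seq_fset1 mcoeffUU. Qed.

(** Both sides expand over pairs of words, and [foldr_cat] turns concatenation of words into
    composition of operators. *)
Lemma free_actM a b v : free_act (a * b) v = free_act a (free_act b v).
Proof.
rewrite malgME free_act_sum [RHS]/free_act; apply: eq_bigr => m _.
rewrite free_act_sum [free_act b v]/free_act linear_sum scaler_sumr /=.
apply: eq_bigr => m' _; rewrite free_actU linearZ scalerA /=.
by rewrite /word_act fmM foldr_cat.
Qed.

Lemma free_act_scal c v : free_act (fscal X c) v = c *: v.
Proof. by rewrite /fscal free_actU /word_act fm1. Qed.

Lemma free_act1 v : free_act 1 v = v.
Proof. by rewrite -mpolyC1E (free_act_scal 1) scale1r. Qed.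

Lemma free_act_gen x v : free_act (fgen k x) v = T x v.
Proof. by rewrite /fgen free_actU scale1r /word_act fmU. Qed.

Lemma free_actX a n v : free_act (a ^+ n) v = iter n (free_act a) v.
Proof.
elim: n => [|n IHn]; first by rewrite expr0 free_act1.
by rewrite exprS free_actM IHn.
Qed.

Definition free_actE := (free_actN, free_actD, free_actM, free_actZ,
  free_actX, free_act_scal, free_act_gen, free_act1).

Variable rel : freeAlg -> Prop.
Hypothesis free_act_rel : forall b, rel b -> forall v, free_act b v = 0.

(** The elements acting as zero form a two-sided ideal containing [rel], and [ideal_gen] is the
    smallest such ideal. *)
Lemma free_act_ideal_gen b v : b \in ideal_gen rel -> free_act b v = 0.
Proof.
move=> /asboolP /(_ (fun b => forall v, free_act b v = 0)); apply=> //.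
split=> [u|a c a0 c0 u|a c e c0 u]; first exact: free_act0.
- by rewrite free_actB a0 c0 subr0.
- by rewrite !free_actM c0 linear0.
Qed.

Lemma free_act_repr (a : freeAlg) v :
  free_act (generic_quotient.repr (\pi_(presAlg rel)%qT a)) v = free_act a v.
Proof.
apply/eqP; rewrite -subr_eq0 -free_actB; apply/eqP/free_act_ideal_gen.
by rewrite Quotient.idealrBE; apply/eqP; rewrite generic_quotient.reprK.
Qed.

Definition pres_act (a : presAlg rel) (v : V) : V :=
  free_act (generic_quotient.repr a) v.

Lemma pres_actDr a u v : pres_act a (u + v) = pres_act a u + pres_act a v.
Proof. exact: linearD. Qed.

Lemma pres_actDl a b v : pres_act (a + b) v = pres_act a v + pres_act b v.
Proof.
rewrite -{1}[a]generic_quotient.reprK -{1}[b]generic_quotient.reprK.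
by rewrite -pres_piD /pres_act free_act_repr free_actD.
Qed.

Lemma pres_act1 v : pres_act 1 v = v.
Proof.
have -> : 1 = \pi_(presAlg rel)%qT 1 by rewrite generic_quotient.piE.
by rewrite /pres_act free_act_repr free_act1.
Qed.

Lemma pres_actM a b v : pres_act (a * b) v = pres_act a (pres_act b v).
Proof.
rewrite -{1}[a]generic_quotient.reprK -{1}[b]generic_quotient.reprK.
rewrite -[_ * _]/(pres_mul _ _) -pi_pres_mul.
by rewrite /pres_act free_act_repr free_actM.
Qed.

Lemma pres_actC c v : pres_act (pscal rel c) v = c *: v.
Proof. by rewrite /pres_act free_act_repr free_act_scal. Qed.

(** Universal property of the presented algebra: operators satisfying the relations extend to a
    representation. *)
Definition pres_rep : representation rel V :=
  Representation pres_actDr pres_actDl pres_act1 pres_actM pres_actC.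

Lemma pres_rep_gen x v : pres_rep (pgen rel x) v = T x v.
Proof. by rewrite /= /pres_act free_act_repr free_act_gen. Qed.

End FreeAlgebraAction.

(** * Central scalars and structural induction in a presented algebra *)

Section PresentedAlgebraTheory.
Variables (k : fieldType) (X : choiceType).
Local Notation freeAlg := (free_algebra k X).
Variable rel : freeAlg -> Prop.
Local Notation pi := (\pi_(presAlg rel)%qT).

Lemma fscal_commr c (a : freeAlg) : fscal X c * a = a * fscal X c.
Proof.
rewrite [a]monalgE mulr_sumr mulr_suml; apply: eq_bigr => m _.
rewrite /fscal !malgM_def !fgmulUU.
by rewrite mul1m mulm1 mulrC.
Qed.

Lemma pres_pi1 : pi 1 = 1.
Proof. by rewrite generic_quotient.piE. Qed.

Lemma pres_piM (a b : freeAlg) : pi (a * b) = pi a * pi b.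
Proof. exact: pi_pres_mul. Qed.

Lemma pres_piN (a : freeAlg) : pi (- a) = - pi a.
Proof. exact: (raddfN \pi_(Quotient.quot (ideal_gen rel))%qT). Qed.

Lemma pres_pi0 : pi 0 = 0.
Proof. exact: (raddf0 \pi_(Quotient.quot (ideal_gen rel))%qT). Qed.

Lemma pres_piX (a : freeAlg) n : pi (a ^+ n) = pi a ^+ n.
Proof.
by elim: n => [|n IHn]; rewrite ?expr0 ?pres_pi1 // !exprS pres_piM IHn.
Qed.

Lemma pres_piZ c (a : freeAlg) : pi (c *: a) = pscal rel c * pi a.
Proof. by rewrite -mul_malgC pres_piM. Qed.

Lemma pscalD c d : pscal rel (c + d) = pscal rel c + pscal rel d.
Proof. by rewrite /pscal -pres_piD /fscal monalgUD. Qed.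

Lemma pscalN c : pscal rel (- c) = - pscal rel c.
Proof. by rewrite /pscal -pres_piN /fscal monalgUN. Qed.

Lemma pscalM c d : pscal rel (c * d) = pscal rel c * pscal rel d.
Proof. by rewrite /pscal -pres_piM /fscal mpolyCM. Qed.

Lemma pscal1 : pscal rel 1 = 1.
Proof. exact: pres_pi1. Qed.

Lemma pscal0 : pscal rel 0 = 0.
Proof. by rewrite -(subrr 1) pscalD pscalN subrr. Qed.

Fact pscal_zmod_morphism : zmod_morphism (pscal rel).
Proof. by move=> c d; rewrite pscalD pscalN. Qed.
HB.instance Definition _ :=
  GRing.isZmodMorphism.Build k (presAlg rel) (pscal rel) pscal_zmod_morphism.

Fact pscal_monoid_morphism : monoid_morphism (pscal rel).
Proof. by split; [apply: pscal1 | apply: pscalM]. Qed.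
HB.instance Definition _ :=
  GRing.isMonoidMorphism.Build k (presAlg rel) (pscal rel) pscal_monoid_morphism.

Lemma pscal_comm c (a : presAlg rel) : pscal rel c * a = a * pscal rel c.
Proof. by rewrite -[a]generic_quotient.reprK -!pres_piM fscal_commr. Qed.

Lemma pres_rel (a b : freeAlg) : rel (a - b) -> pi a = pi b.
Proof.
move=> rab; have: a - b \in ideal_gen rel by apply/asboolP => I _; exact.
by rewrite Quotient.idealrBE => /eqP.
Qed.

Lemma pres_relM c (a b : freeAlg) : rel (a * b - c *: (b * a)) ->
  pi a * pi b = pscal rel c * (pi b * pi a).
Proof. by move/pres_rel; rewrite pres_piZ !pres_piM. Qed.

(** Scalars and generators generate the algebra as a ring, so properties closed under sums and
    products can be checked on them. *)
Lemma presAlg_ind (P : presAlg rel -> Prop) :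
    (forall c, P (pscal rel c)) -> (forall x, P (pgen rel x)) ->
    (forall a b, P a -> P b -> P (a + b)) ->
    (forall a b, P a -> P b -> P (a * b)) ->
  forall a, P a.
Proof.
move=> Pscal Pgen PD PM a; rewrite -[a]generic_quotient.reprK.
rewrite [generic_quotient.repr a]monalgE.
elim: (X in \sum_(_ <- X) _) => [|m s IHs].
  by rewrite big_nil pres_pi0 -pscal0.
rewrite big_cons pres_piD; apply: PD => //.
(* The coefficient is generalized so that it travels to the empty word as letters are peeled off. *)
case: m => w; set c := _@__; move: c.
elim: w => [|x w IHw] c; first by rewrite -fmoneE; apply: Pscal.
have -> : << c *g FMonom (x :: w) >> = fgen k x * << c *g FMonom w >>.
  rewrite /fgen malgM_def fgmulUU mul1r; congr mkmalgU.
  by apply/eqP; rewrite fmP fmM fmU.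
by rewrite pres_piM; apply: PM; [apply: Pgen | apply: IHw].
Qed.

(** Homogeneity holds because a scalar acts as the element [pscal rel c], which is central. *)
Lemma ract_linear (V : lmodType k) (rho : representation rel V) a :
  linear (rho a).
Proof.
by move=> c u v; rewrite ractDr -(ractC rho) -ractM -pscal_comm ractM ractC.
Qed.
HB.instance Definition _ (V : lmodType k) (rho : representation rel V) a :=
  GRing.isLinear.Build k V V _ (Defs.ract rho a) (ract_linear rho a).

End PresentedAlgebraTheory.

(** Schur's lemma: the kernel [K] is a proper submodule, hence zero, and the image [I] a nonzero
    one, hence everything. *)
Lemma irreducible_module_iso (A : pzRingType) (N M : lmodType A)
    (f : {linear N -> M}) :
  irreducible_module N -> irreducible_module M -> (exists v, f v != 0) ->
  module_iso M N.
Proof.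
move=> [_ simN] [_ simM] [v fv0].
pose K : {pred N} := [pred u | f u == 0].
pose I : {pred M} := fun u => `[< exists v, f v = u >].
have K0 : K =i pred1 0.
  case: (simN K) => [||KT] //.
    split=> [|a u w]; first by rewrite inE linear0.
    by rewrite !inE linearP => /eqP-> /eqP->; rewrite scaler0 addr0.
  by have := KT v; rewrite !inE (negPf fv0).
have IT : I =i predT.
  case: (simM I) => [|I0|] //.
    split=> [|a u w]; first by apply/asboolP; exists 0; rewrite linear0.
    move=> /asboolP[u' <-] /asboolP[w' <-]; apply/asboolP.
    by exists (a *: u' + w'); rewrite linearP.
  have: f v \in I by apply/asboolP; exists v.
  by rewrite I0 inE (negPf fv0).
have injf : injective f.
  move=> u w fuw; apply/eqP; rewrite -subr_eq0.
  by have := K0 (u - w); rewrite !inE linearB fuw subrr eqxx => <-.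
(* A section of [f] is chosen by surjectivity; injectivity of [f] makes it linear and a two-sided
   inverse. *)
have [g gK] : {g : M -> N & forall u, f (g u) = u}.
  by apply: (boolp.choice (P := fun u v => f v = u)) => u; apply/asboolP/IT.
have gL : linear g by move=> a u w; apply: injf; rewrite linearP !gK.
pose gl := GRing.isLinear.Build A M N _ g gL.
pose h : {linear M -> N} := HB.pack g gl.
exists h; exists f => u; first exact: gK.
by apply: injf; exact: gK.
Qed.

Lemma iter_ordS n (i : 'I_n) m : iter m (@ordS n) i = ((i + m) %% n)%N :> nat.
Proof.
elim: m => [|m IHm] /=; first by rewrite addn0 modn_small.
by rewrite IHm addnS -addn1 modnDml addn1.
Qed.

(** * The modules L(eta) *)

Section QuantumPlane.
Variables (k : fieldType) (gT : finGroupType) (D : quantum_plane_datum k gT).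
Variable xi : gT -> k.
Hypotheses (alpha1 : alpha D xi = 1) (nu1 : nu D = 1) (beta0 : beta D xi = 0).
Local Notation q := (chi1 D (g1 D)).
Local Notation r := (ord_r D).
Local Notation rel := (Axi_rel D xi).

Lemma character1 (chi : gT -> k) : is_character [set: gT] chi -> chi 1%g = 1.
Proof.
move=> [chi0 chiM]; apply: (mulfI (chi0 1%g (in_setT _))).
by rewrite mulr1 -chiM ?in_setT // mulg1.
Qed.

Lemma characterM (chi : gT -> k) g h : is_character [set: gT] chi ->
  chi (g * h)%g = chi g * chi h.
Proof. by move=> [_ chiM]; rewrite chiM ?in_setT. Qed.

Lemma characterX (chi : gT -> k) g n : is_character [set: gT] chi ->
  chi (g ^+ n)%g = chi g ^+ n.
Proof.
move=> chiP; elim: n => [|n IHn]; first by rewrite character1.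
by rewrite expgS exprS characterM ?IHn.
Qed.

Lemma character_neq0 (chi : gT -> k) g : is_character [set: gT] chi ->
  chi g != 0.
Proof. by move=> [chi0 _]; rewrite chi0 ?in_setT. Qed.

Let chi1P := chi1P D.
Let chi2P := chi2P D.

(** Otherwise [alpha11] would vanish, and with it [alpha D xi], which is 1. *)
Lemma chi1_expr_r h : chi1 D h ^+ r = 1.
Proof.
suff: forall h, chi1 D h ^+ r = 1 by [].
apply/not_notP => chi1r; have a0 := alpha11P (or_intror chi1r).
by move/eqP: alpha1; rewrite /alpha a0 mul0r eq_sym oner_eq0.
Qed.

Lemma chi12 h : chi1 D h * chi2 D h = 1.
Proof.
suff: forall h, chi1 D h * chi2 D h = 1 by [].
apply/not_notP => chi12; have n0 := nuP (or_intror chi12).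
by move/eqP: nu1; rewrite n0 eq_sym oner_eq0.
Qed.

Lemma chi2E h : chi2 D h = (chi1 D h)^-1.
Proof. by rewrite -[LHS](mulKf (character_neq0 h chi1P)) chi12 mulr1. Qed.

Lemma chi1_g2 : chi1 D (g2 D) = q.
Proof.
apply: (mulIf (character_neq0 (g1 D) chi2P)).
by rewrite chi_cross chi12.
Qed.

Lemma chi1_g1g2 : chi1 D (g1 D * g2 D)%g = q ^+ 2.
Proof. by rewrite characterM // chi1_g2. Qed.

(** The value of [chi2] at [g2] is the inverse of [q], so the two orders divide each other. *)
Lemma ord_s_r : ord_s D = r.
Proof.
apply/eqP; rewrite eqn_dvd (prim_order_dvd (s_order D)).
rewrite (prim_order_dvd (r_order D)) -[q ^+ _]invrK -exprVn -chi1_g2 -chi2E.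
rewrite (prim_expr_order (s_order D)) invr1 eqxx andbT.
by rewrite chi2E exprVn chi1_expr_r invr1.
Qed.

Lemma q_neq0 : q != 0. Proof. exact: character_neq0. Qed.

Lemma q_neq1 : q != 1.
Proof.
by rewrite -[q]expr1 -(prim_order_dvd (r_order D)) dvdn1 neq_ltn r_gt1 orbT.
Qed.

Lemma r_gt0 : (0 < r)%N. Proof. exact: ltnW (r_gt1 D). Qed.

Lemma coefS_E eta i :
  coef D eta i.+1
    = q * (coef D eta i - (eta (g1 D * g2 D)%g * (q ^+ 2) ^+ i - 1)).
Proof. by rewrite /= nu1 mul1r chi1_g1g2. Qed.

Lemma coef_closed eta i :
  (1 - q) * coef D eta i
    = (1 - q ^+ i) * (q - eta (g1 D * g2 D)%g * q ^+ i).
Proof.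
elim: i => [|i IHi]; first by rewrite expr0 subrr mul0r mulr0.
(* With [exprAC] every power is expressed through [q] and [Q], leaving a polynomial identity. *)
rewrite coefS_E mulrCA mulrBr IHi exprAC (exprS _ i); set Q := q ^+ i; ring.
Qed.

Lemma coef_r eta : coef D eta r = 0.
Proof.
apply: (@mulfI _ (1 - q)); first by rewrite subr_eq0 eq_sym q_neq1.
by rewrite coef_closed chi1_expr_r subrr mul0r mulr0.
Qed.

(** Only the wrap-around from r - 1 to 0 matters; there both sides vanish by [coef_r]. *)
Lemma coef_ordS eta (i : 'I_r) : coef D eta (ordS i) = coef D eta i.+1.
Proof.
rewrite [nat_of_ord (ordS i)]/=.
have [->|ltir] := eqVneq i.+1 r; first by rewrite modnn coef_r.
by rewrite modn_small // ltn_neqAle ltir ltn_ord.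
Qed.

Lemma chi1_ordS h (i : 'I_r) : chi1 D h ^+ ordS i = chi1 D h ^+ i.+1.
Proof. by rewrite expr_mod ?chi1_expr_r. Qed.

(** * The operators on L(eta) satisfy the relations *)

Section Existence.
Variable eta : fiber D xi.
Let etaP := fiber_charP eta.

Definition L_gen_row (x : gens gT) (i : 'I_r) : 'rV[k]_r :=
  match x with
  | inl h => (chi1 D h ^+ i * eta h) *: delta_mx 0 i
  | inr false => delta_mx 0 (ordS i)
  | inr true => coef D eta i *: delta_mx 0 (ord_pred i)
  end.

(** Vectors are rows multiplied by matrices on the right, so row i of the matrix is the image of
    f_i. *)
Definition L_gen (x : gens gT) : {linear 'rV[k]_r -> 'rV[k]_r} :=
  mulmxr (\matrix_i L_gen_row x i).

Lemma L_gen_delta x i : L_gen x (delta_mx 0 i) = L_gen_row x i.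
Proof. by rewrite /= -rowE rowK. Qed.

Lemma L_gen_xn n i :
  iter n (free_act L_gen (fgen k (genX gT))) (delta_mx 0 i)
    = delta_mx 0 (iter n (@ordS r) i).
Proof. by elim: n => // n IHn; rewrite !iterS IHn free_act_gen L_gen_delta. Qed.

(** Each y lowers the index by one, and the last one kills f_0 because c_0 = 0. *)
Lemma L_gen_ySn (i : 'I_r) :
  iter i.+1 (free_act L_gen (fgen k (genY gT))) (delta_mx 0 i) = 0.
Proof.
case: i => i; elim: i => [|i IHi] ltir.
  by rewrite /iter free_act_gen L_gen_delta /= scale0r.
rewrite iterSr free_act_gen L_gen_delta /L_gen_row.
set j := ord_pred _.
have -> : j = Ordinal (ltnW ltir).
  by apply: val_inj; rewrite /= modnDr modn_small // ltnW.
have iterZ n c u : iter n (free_act L_gen (fgen k (genY gT))) (c *: u)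
    = c *: iter n (free_act L_gen (fgen k (genY gT))) u.
  by elim: n => // n IHn; rewrite !iterS IHn linearZ.
by rewrite iterZ IHi scaler0.
Qed.

Lemma L_gen_rel b : rel b -> forall v, free_act L_gen b v = 0.
Proof.
move=> rb v; rewrite [v]row_sum_delta linear_sum big1 // => i _.
rewrite linearZ -[RHS](scaler0 _ (v 0 i)) /=; congr (_ *: _).
case: rb => [|g h|g gL|h|h|||]; rewrite free_actB ?free_actE;
  apply/eqP; rewrite subr_eq0; apply/eqP; rewrite ?L_gen_delta.
- by rewrite /= !character1 // expr1n mulr1 scale1r.
- rewrite [L_gen_row (inl h) _]/L_gen_row linearZ L_gen_delta /= scalerA.
  by congr (_ *: _); rewrite !characterM // exprMn; ring.
- rewrite /= (fiber_res eta gL); move: gL; rewrite inE => /andP[/eqP-> _].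
  by rewrite expr1n mul1r.
- rewrite [L_gen_row (inl h) _]/L_gen_row linearZ !L_gen_delta /= scalerA.
  by rewrite expr_mod ?chi1_expr_r // mulrA -exprS.
- rewrite [L_gen_row (genY gT) _]/L_gen_row [L_gen_row (inl h) _]/L_gen_row.
  rewrite !linearZ !L_gen_delta /= !scalerA; congr (_ *: _).
  (* At i = 0 the predecessor is r - 1, and the equation rests on [chi1_expr_r]. *)
  have -> : chi1 D h ^+ i = chi1 D h * chi1 D h ^+ ord_pred i.
    by rewrite -exprS -chi1_ordS ord_predK.
  transitivity (chi1 D h * chi2 D h * (coef D eta i
    * (chi1 D h ^+ ord_pred i * eta h))); last by rewrite /=; ring.
  by rewrite chi12 mul1r.
- rewrite L_gen_xn alpha1 scale1r; congr delta_mx; apply: val_inj.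
  by rewrite [LHS]iter_ordS modnDr modn_small.
(* As s = r > i, the first i + 1 applications of y already kill f_i, and the remaining ones fix
   0. *)
- rewrite beta0 scale0r ord_s_r -[X in iter X](subnK (ltn_ord i)) iterD L_gen_ySn.
  by rewrite iter_fix // linear0.
(* Here xy and yx multiply f_i by c_i and c_(i+1), so the relation is the recursion for c_(i+1)
   divided by q. *)
- rewrite [L_gen_row (genY gT) i]/L_gen_row linearZ !L_gen_delta /=.
  rewrite nu1 ord_predK ordSK coef_ordS coefS_E // chi1_g1g2 scale1r scalerA.
  rewrite -scalerBl -scalerDl; congr (_ *: _).
  by rewrite mulrA chi2E mulVf ?q_neq0 //; ring.
Qed.

Lemma L_action_exists : exists rho : representation rel (W D), L_action eta rho.
Proof.
exists (pres_rep L_gen_rel); split=> [i|h i|i];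
  by rewrite [LHS]pres_rep_gen L_gen_delta.
Qed.

End Existence.

(** * Irreducibility of L(eta) through its weights *)

Section Irreducible.
Variables (eta : fiber D xi) (rho : representation rel (W D)).
Hypothesis rhoP : L_action eta rho.
Let etaP := fiber_charP eta.

Lemma ract_Ah h (v : W D) j :
  (rho (Ah D xi h) v : 'rV[k]_r) 0 j = chi1 D h ^+ j * eta h * (v : 'rV[k]_r) 0 j.
Proof.
have [_ rhoh _] := rhoP.
rewrite [v in rho _ v]row_sum_delta linear_sum summxE (bigD1 j) //=.
have rho_delta i : rho (Ah D xi h) (delta_mx 0 i)
    = (chi1 D h ^+ i * eta h) *: delta_mx 0 i := rhoh h i.
rewrite big1 => [|i neq_ij]; rewrite linearZ /= rho_delta !mxE eqxx /=.
  by rewrite eqxx mulr1 addr0 mulrC.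
by rewrite eq_sym (negPf neq_ij) !mulr0.
Qed.

Lemma ract_Ax_iter (i : 'I_r) n :
  iter n (rho (Ax D xi)) (delta_mx 0 i) = delta_mx 0 (iter n (@ordS r) i).
Proof.
have [rhox _ _] := rhoP.
by elim: n => // n IHn; rewrite !iterS IHn; apply: rhox.
Qed.

Lemma sum_expr_root (z : k) n : z ^+ n = 1 -> z != 1 -> \sum_(m < n) z ^+ m = 0.
Proof.
move=> zn1 z1; apply: (@mulfI _ (z - 1)); first by rewrite subr_eq0.
by rewrite -subrX1 zn1 subrr mulr0.
Qed.

(* The finite Fourier transform over the powers of g1 projects onto the
   weight line of f_i, because the r weights take distinct values at g1. *)
Lemma weight_projection (i : 'I_r) (v : 'rV[k]_r) :
  \sum_(m < r) (q ^+ i * eta (g1 D)) ^- m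
      *: (rho (Ah D xi (g1 D ^+ m)%g) v : 'rV[k]_r)
    = (r%:R * v 0 i) *: delta_mx 0 i.
Proof.
apply/rowP => j; rewrite summxE !mxE eqxx /=.
have weight0 : q ^+ i * eta (g1 D) != 0.
  by rewrite mulf_neq0 ?expf_neq0 ?q_neq0 ?character_neq0.
(* The factors involving eta cancel, leaving a geometric sum with ratio q^(j-i). *)
transitivity (\sum_(m < r) (q ^+ j / q ^+ i) ^+ m * v 0 j).
  apply: eq_bigr => m _; rewrite mxE ract_Ah mulrA; congr (_ * _).
  rewrite !characterX // exprAC -exprMn -exprVn -exprMn; congr (_ ^+ _).
  by rewrite invfM mulrACA mulVf ?character_neq0 // mulr1 mulrC.
rewrite -mulr_suml; have [->|neq_ji] := eqVneq j i.
  rewrite divff ?expf_neq0 ?q_neq0 // mulr1 (eq_bigr (fun=> 1)).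
    by rewrite sumr_const card_ord.
  by move=> m _; rewrite expr1n.
rewrite sum_expr_root ?mul0r ?mulr0 //.
  by rewrite exprMn exprVn !(exprAC _ _ r) chi1_expr_r !expr1n divr1.
apply: contra neq_ji => /eqP qij; rewrite -val_eqE /=.
rewrite -(modn_small (ltn_ord i)) -(modn_small (ltn_ord j)).
rewrite -(eq_prim_root_expr (r_order D)); apply/eqP.
by rewrite -[RHS]mul1r -qij divfK ?expf_neq0 ?q_neq0.
Qed.

Lemma L_irreducible : irreducible_module (rep_module rho).
Proof.
split; first by exists (delta_mx 0 (Ordinal r_gt0)); apply/rV0Pn;
  exists (Ordinal r_gt0); rewrite mxE !eqxx oner_eq0.
move=> S [S0 Slin].
have SA (a : Axi D xi) (u : W D) : u \in S -> rho a u \in S.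
  by move=> uS; have := Slin a u 0 uS S0; rewrite addr0.
have SZ c (u : W D) : u \in S -> c *: u \in S.
  by move=> uS; rewrite -(ractC rho); apply: SA.
have SD (u v : W D) : u \in S -> v \in S -> u + v \in S.
  by move=> uS vS; have := Slin 1 u v uS vS; rewrite scale1r.
have [[v [vS]]|S_0] := pselect (exists v, v \in S /\ v != 0); last first.
  left=> u; rewrite inE; apply/idP/eqP => [uS|->//].
  by apply/eqP/not_notP => u0; apply: S_0; exists u; split=> //; apply/negP.
move=> /(rV0Pn (v : 'rV[k]_r))[i vi0]; right=> u; rewrite inE.
have Sdelta_i : (delta_mx 0 i : W D) \in S.
  (* The integer r is nonzero in k because k contains a primitive r-th root of unity. *)
  have ci0 : r%:R * (v : 'rV[k]_r) 0 i != 0.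
    by rewrite mulf_neq0 ?(prim_root_natf_neq0 (r_order D)).
  rewrite -[delta_mx 0 i](scalerK ci0) SZ // -weight_projection.
  by apply: (big_ind (fun u : W D => u \in S)) => // m _; rewrite SZ ?SA.
have Sdelta j : (delta_mx 0 j : W D) \in S.
  (* Starting at i, the number j + (r - i) of steps leads to j + r, which is j modulo r, without
     subtracting i from j. *)
  have -> : delta_mx 0 j = iter (j + (r - i)) (rho (Ax D xi)) (delta_mx 0 i).
    rewrite ract_Ax_iter; congr delta_mx; apply: val_inj.
    rewrite [RHS]iter_ordS addnCA subnKC ?modnDr ?modn_small //.
    exact: ltnW.
  by elim: (j + _)%N => // n IHn; rewrite iterS SA.
rewrite [u](row_sum_delta (u : 'rV[k]_r)).
by apply: (big_ind (fun u : W D => u \in S)) => // j _; rewrite SZ.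
Qed.

End Irreducible.

(** The image of f_0 is a nonzero vector of weight eta in the target; any index i with nonzero
    coordinate there serves as m. *)
Lemma L_iso_weights (eta eta' : fiber D xi)
    (rho rho' : representation rel (W D)) :
  L_action eta rho -> L_action eta' rho' ->
  module_iso (rep_module rho) (rep_module rho') ->
  exists m : int, forall h, eta h = eta' h * chi1 D h ^ m.
Proof.
move=> rhoP rho'P [f fbij].
pose f0 : W D := delta_mx 0 (Ordinal r_gt0).
have [_ rhoh _] := rhoP.
have : f f0 != 0.
  rewrite -(linear0 f) (inj_eq (bij_inj fbij)).
  by apply/rV0Pn; exists (Ordinal r_gt0); rewrite mxE !eqxx oner_eq0.
move=> /(rV0Pn (f f0 : 'rV[k]_r))[i ui0]; exists (i : nat) => h.
have fh : rho' (Ah D xi h) (f f0) = eta h *: (f f0 : W D).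
  rewrite -[LHS](linearZ_LR f (Ah D xi h) f0) -[RHS](ractC rho').
  rewrite -[RHS](linearZ_LR f (pscal rel (eta h)) f0); congr (f _).
  rewrite [RHS](ractC rho); have := rhoh h (Ordinal r_gt0).
  by rewrite expr0 mul1r.
apply: (mulIf ui0); rewrite -exprnP [eta' h * _]mulrC -(ract_Ah rho'P).
by rewrite fh mxE.
Qed.

End QuantumPlane.

(** * Classification of the irreducible modules *)

Section ScalarAction.
Variables (k : fieldType) (A : pzRingType) (sc : {rmorphism k -> A}).
Hypothesis sc_comm : forall c a, sc c * a = a * sc c.

(** The left side evaluates the split polynomial at [a]; evaluation is multiplicative because
    scalars commute with [a]. *)
Lemma horner_prod_XsubC (a : A) (zs : seq k) :
  \sum_(i < (size zs).+1) sc (\prod_(z <- zs) ('X - z%:P))`_i * a ^+ i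
    = \prod_(z <- zs) (a - sc z).
Proof.
elim: zs => [|z zs IHzs].
  by rewrite !big_nil big_ord1 coef1 rmorph1 mulr1.
rewrite !big_cons -IHzs mulrBl !mulr_sumr -/(size (z :: zs)).
set p := \prod_(_ <- _) _.
(* This coefficient lies beyond the degree of [p]; dropping it aligns the ranges of the two sums. *)
have p0 : p`_(size zs).+1 = 0.
  by rewrite nth_default // size_prod_XsubC.
rewrite (eq_bigr (fun i : 'I__ => sc ('X * p)`_i * a ^+ i
    - sc z * (sc p`_i * a ^+ i))) => [|i _].
  rewrite sumrB; congr (_ - _); last first.
    by rewrite big_ord_recr /= p0 rmorph0 mul0r mulr0 addr0.
  rewrite big_ord_recl coefXM rmorph0 mul0r add0r; apply: eq_bigr => i _.
  by rewrite coefXM /= exprS !mulrA sc_comm.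
by rewrite mulrBl coefB coefCM rmorphB mulrBl rmorphM mulrA.
Qed.

Lemma horner_XnsubC1 (a : A) n : (0 < n)%N ->
  \sum_(i < n.+1) sc ('X^n - 1%:P)`_i * a ^+ i = a ^+ n - 1.
Proof.
move=> n_gt0.
under eq_bigr => i _ do rewrite coefB coefXn coefC rmorphB mulrBl.
rewrite sumrB; congr (_ - _).
  rewrite big_ord_recr /= eqxx rmorph1 mul1r big1 ?add0r // => i _.
  by rewrite ltn_eqF // rmorph0 mul0r.
rewrite big_ord_recl /= rmorph1 mul1r big1 ?addr0 // => i _.
by rewrite rmorph0 mul0r.
Qed.

Lemma prod_subr_roots (a : A) n zs : (0 < n)%N ->
    'X^n - 1%:P = \prod_(z <- zs) ('X - z%:P) ->
  a ^+ n - 1 = \prod_(z <- zs) (a - sc z).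
Proof.
move=> n_gt0 Xzs; have size_zs : size zs = n.
  by apply: succn_inj; rewrite -(size_XnsubC (1 : k) n_gt0) Xzs size_prod_XsubC.
by rewrite -horner_prod_XsubC -Xzs size_zs horner_XnsubC1.
Qed.

Variable M : lmodType A.

Lemma sc_scaleA c d (w : M) :
  sc c *: (sc d *: w) = sc (c * d) *: w.
Proof. by rewrite scalerA -rmorphM. Qed.

Lemma sc_scaleC c (a : A) (w : M) :
  a *: (sc c *: w) = sc c *: (a *: w).
Proof. by rewrite !scalerA; congr (_ *: _); apply/esym/sc_comm. Qed.

Lemma sc_scaleK c (w : M) : c != 0 -> sc c^-1 *: (sc c *: w) = w.
Proof. by move=> c0; rewrite sc_scaleA mulVf // rmorph1 scale1r. Qed.

(** Nonzero scalars act invertibly, so a nonzero eigenvector determines its eigenvalue. *)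
Lemma sc_scaleI (w : M) : w != 0 -> injective (fun c => sc c *: w).
Proof.
move=> w0 c d /eqP; rewrite -subr_eq0 -scalerBl -rmorphB => /eqP cdw.
apply/eqP; rewrite -subr_eq0; apply: contraNT w0 => cd0.
by rewrite -(sc_scaleK w cd0) cdw scaler0.
Qed.

Section BasisMap.
Variables (n : nat) (b : 'I_n -> M).

Definition basis_map (v : 'rV[k]_n) : M := \sum_i sc (v 0 i) *: b i.

Lemma basis_mapD u v : basis_map (u + v) = basis_map u + basis_map v.
Proof.
rewrite -big_split; apply: eq_bigr => i _.
by rewrite mxE rmorphD scalerDl.
Qed.

Lemma basis_mapZ c v : basis_map (c *: v) = sc c *: basis_map v.
Proof.
by rewrite scaler_sumr; apply: eq_bigr => i _; rewrite mxE sc_scaleA.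
Qed.

Lemma basis_map_delta i : basis_map (delta_mx 0 i) = b i.
Proof.
rewrite /basis_map (bigD1 i) //= mxE !eqxx rmorph1 scale1r.
rewrite big1 ?addr0 // => j ji.
by rewrite mxE (negPf ji) andbF rmorph0 scale0r.
Qed.

Lemma basis_map_comm (T : {linear 'rV[k]_n -> 'rV[k]_n}) (a : A) :
    (forall i, basis_map (T (delta_mx 0 i)) = a *: b i) ->
  forall v, basis_map (T v) = a *: basis_map v.
Proof.
move=> Ta v; have basis_map0 : basis_map 0 = 0.
  by have := basis_mapZ 0 0; rewrite scale0r rmorph0 scale0r.
rewrite [v in LHS]row_sum_delta linear_sum.
rewrite (big_morph basis_map basis_mapD basis_map0) scaler_sumr.
by apply: eq_bigr => i _; rewrite linearZ /= basis_mapZ Ta sc_scaleC.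
Qed.

End BasisMap.

(** Either the rightmost factor, which acts first, kills [w], making it an eigenvector, or it yields
    a nonzero vector killed by the shorter product. [P] carries conditions to be preserved. *)
Lemma eigenvector_of_split (a : A) (P : M -> Prop) (zs : seq k) (w : M) :
    (forall z u, P u -> P (a *: u - sc z *: u)) ->
    P w -> w != 0 -> (\prod_(z <- zs) (a - sc z)) *: w = 0 ->
  exists u, [/\ P u, u != 0 & exists z, a *: u = sc z *: u].
Proof.
move=> Pstable; elim/last_ind: zs w => [|zs z IHzs] w Pw w0.
  by rewrite big_nil scale1r => w_0; rewrite w_0 eqxx in w0.
rewrite -cats1 big_cat big_seq1 -scalerA scalerBl => Pw0.
have [az|az] := eqVneq (a *: w) (sc z *: w).
  by exists w; split=> //; exists z.
by apply: IHzs Pw0; [apply: Pstable | rewrite subr_eq0].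
Qed.

End ScalarAction.

(* Modules are classified over an abstract ring A carrying the relations of A(xi),
   which hides the construction of presAlg as a quotient. *)
Record Axi_relations (k : fieldType) (gT : finGroupType)
    (D : quantum_plane_datum k gT) (xi : gT -> k) (A : pzRingType)
    (sc : {rmorphism k -> A}) (aH : gT -> A) (aX aY : A) : Prop := {
  Axi_sc_comm : forall c a, sc c * a = a * sc c;
  Axi_H1 : aH 1%g = 1;
  Axi_HM : forall g h, aH (g * h)%g = aH g * aH h;
  Axi_HLambda : forall g, g \in Lambda D -> aH g = sc (xi g);
  Axi_HX : forall h, aH h * aX = sc (chi1 D h) * (aX * aH h);
  Axi_HY : forall h, aH h * aY = sc (chi2 D h) * (aY * aH h);
  Axi_Xr : aX ^+ ord_r D = sc (alpha D xi);
  Axi_Ys : aY ^+ ord_s D = sc (beta D xi);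
  Axi_XY : aX * aY = sc (chi2 D (g1 D)) * (aY * aX)
    + sc (nu D) * (aH (g1 D * g2 D)%g - 1)
}.

Section Classification.
Variables (k : closedFieldType) (gT : finGroupType).
Variables (D : quantum_plane_datum k gT) (xi : gT -> k).
Hypothesis abG : abelian [set: gT].
Hypotheses (alpha1 : alpha D xi = 1) (nu1 : nu D = 1) (beta0 : beta D xi = 0).
Variables (A : pzRingType) (sc : {rmorphism k -> A}) (aH : gT -> A) (aX aY : A).
Hypothesis relA : Axi_relations D xi sc aH aX aY.
Variable M : lmodType A.
Let sc_comm := Axi_sc_comm relA.
Local Notation q := (chi1 D (g1 D)).
Local Notation r := (ord_r D).

Lemma aHX g n : aH (g ^+ n)%g = aH g ^+ n.
Proof.
elim: n => [|n IHn]; first by rewrite (Axi_H1 relA).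
by rewrite expgS exprS (Axi_HM relA) IHn.
Qed.

(** Since [beta] is 0, y is nilpotent; the last nonzero vector among the y^n v is in its kernel. *)
Lemma lowering_kernel (v : M) : v != 0 -> exists2 w : M, w != 0 & aY *: w = 0.
Proof.
move=> v0; have : aY ^+ ord_s D *: v = 0.
  by rewrite (Axi_Ys relA) beta0 rmorph0 scale0r.
elim: (ord_s D) => [|n IHn]; first by move/eqP; rewrite scale1r (negPf v0).
rewrite exprS -scalerA => yn0.
by have [/IHn|] := eqVneq (aY ^+ n *: v) 0; last by exists (aY ^+ n *: v).
Qed.

(** Group elements are diagonalized one at a time: each has finite order and preserves the kernel of
    y and the eigenspaces of the earlier ones. *)
Lemma common_eigenvector (w : M) (s : seq gT) : w != 0 -> aY *: w = 0 ->
  exists u : M, [/\ aY *: u = 0, u != 0 &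
    {in s, forall h, exists z, aH h *: u = sc z *: u}].
Proof.
move=> w0 yw0; elim: s => [|h s [u [yu0 u0 us]]]; first by exists w.
pose P (u : M) := aY *: u = 0 /\
  {in s, forall h, exists z, aH h *: u = sc z *: u}.
have Pstable z v : P v -> P (aH h *: v - sc z *: v).
  move=> [yv0 vs]; split=> [|g gs].
    rewrite scalerBr (sc_scaleC sc_comm) yv0 scaler0 subr0.
    (* Moving y past h costs the factor [chi2 D h], which is nonzero and can be cancelled. *)
    rewrite -[LHS](sc_scaleK sc _ (character_neq0 h (chi2P D))).
    suff -> : sc (chi2 D h) *: (aY *: (aH h *: v)) = 0 by rewrite scaler0.
    by rewrite [aY *: _]scalerA [LHS]scalerA -(Axi_HY relA) -scalerA yv0 scaler0.
  have [y gv] := vs g gs; exists y.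
  have ghv : aH g *: (aH h *: v) = sc y *: (aH h *: v).
    rewrite scalerA -(Axi_HM relA) (centsP abG) ?in_setT // (Axi_HM relA).
    rewrite -scalerA gv.
    by rewrite (sc_scaleC sc_comm).
  by rewrite !scalerBr ghv (sc_scaleC sc_comm) gv (sc_scaleC sc_comm).
have [zs Xzs] := closed_field_poly_normal ('X^(#[h]%g) - 1%:P : {poly k}).
have lead1 : lead_coef ('X^(#[h]%g) - 1%:P : {poly k}) = 1.
  by apply/eqP; apply: monicXnsubC; apply: order_gt0.
have [||v [[yv0 vs] v0 vh]] := eigenvector_of_split (zs := zs) Pstable _ u0.
- by [].
- rewrite -(@prod_subr_roots _ _ _ sc_comm _ #[h]%g) ?order_gt0 //.
    by rewrite -aHX expg_order (Axi_H1 relA) subrr scale0r.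
  by rewrite Xzs lead1 scale1r.
exists v; split=> // g; rewrite inE => /predU1P[->|] //; exact: vs.
Qed.

Lemma weight_vector : irreducible_module M ->
  exists (eta : fiber D xi) (w : M), [/\ w != 0, aY *: w = 0 &
    forall h, aH h *: w = sc (eta h) *: w].
Proof.
move=> [[v v0] _]; have [w w0 yw0] := lowering_kernel v0.
have [u [yu0 u0 us]] := common_eigenvector (enum gT) w0 yw0.
have [eta uh] : {eta : gT -> k & forall h, aH h *: u = sc (eta h) *: u}.
  apply: (boolp.choice (P := fun h c => aH h *: u = sc c *: u)) => h.
  by apply: us; rewrite mem_enum.
(* The eigenvalues were chosen separately for each h; uniqueness on [u] makes them
   multiplicative. *)
have etaM : {morph eta : g h / (g * h)%g >-> g * h}.
  move=> g h; apply: (sc_scaleI (sc := sc) u0).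
  rewrite -uh (Axi_HM relA) -scalerA uh.
  by rewrite (sc_scaleC sc_comm) uh sc_scaleA mulrC.
have eta1 : eta 1%g = 1.
  by apply: (sc_scaleI (sc := sc) u0); rewrite -uh (Axi_H1 relA) rmorph1.
have etaP : is_character [set: gT] eta.
  split=> [h _|g h _ _]; last exact: etaM.
  by apply/eqP => eta0; move/eqP: eta1; rewrite -(mulgV h) etaM eta0 mul0r
    eq_sym oner_eq0.
have eta_xi : {in Lambda D, eta =1 xi}.
  move=> g gL; apply: (sc_scaleI (sc := sc) u0).
  by rewrite -uh (Axi_HLambda relA).
by exists (Fiber etaP eta_xi), u.
Qed.

Section WeightVector.
Variables (eta : gT -> k) (w : M).
Hypotheses (yw0 : aY *: w = 0) (hw : forall h, aH h *: w = sc (eta h) *: w).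

Lemma weight_Xn h n :
  aH h *: (aX ^+ n *: w) = sc (chi1 D h ^+ n * eta h) *: (aX ^+ n *: w).
Proof.
elim: n => [|n IHn]; first by rewrite expr0 mul1r scale1r hw.
rewrite exprS -scalerA scalerA (Axi_HX relA) -!scalerA IHn.
rewrite (sc_scaleC sc_comm) sc_scaleA.
by rewrite mulrA -exprS.
Qed.

Lemma lower_XSn n :
  aY *: (aX ^+ n.+1 *: w) = sc (coef D eta n.+1) *: (aX ^+ n *: w).
Proof.
(* This is the relation for xy solved for yx, with q the inverse of [chi2] at [g1]. *)
have yxE (u : M) : aY *: (aX *: u)
    = sc q *: (aX *: (aY *: u) - (aH (g1 D * g2 D)%g *: u - u)).
  rewrite !scalerA (Axi_XY relA) nu1 rmorph1 mul1r scalerDl.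
  rewrite scalerBl scale1r addrK.
  rewrite chi2E // -[X in sc q *: X]scalerA sc_scaleA mulfV ?q_neq0 //.
  by rewrite rmorph1 scale1r.
elim: n => [|n IHn]; rewrite exprS -scalerA yxE coefS_E // rmorphM -scalerA.
  rewrite expr0 scale1r yw0 scaler0 hw mulr1; congr (_ *: _).
  by rewrite /= !rmorphB rmorph0 rmorph1 !scalerBl scale1r scale0r.
rewrite IHn weight_Xn (sc_scaleC sc_comm) [aX *: _]scalerA -exprS.
rewrite !rmorphB rmorph1 !scalerBl scale1r chi1_g1g2 //.
by rewrite [_ * eta _]mulrC.
Qed.

End WeightVector.

End Classification.

(** * The homomorphism from L(eta) to an irreducible module *)

Section LiftingModules.
Variables (k : closedFieldType) (gT : finGroupType).
Variables (D : quantum_plane_datum k gT) (xi : gT -> k).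
Hypothesis abG : abelian [set: gT].
Hypotheses (alpha1 : alpha D xi = 1) (nu1 : nu D = 1) (beta0 : beta D xi = 0).
Local Notation rel := (Axi_rel D xi).
Local Notation r := (ord_r D).

Lemma Axi_relationsP :
  @Axi_relations k gT D xi (Axi D xi) (pscal rel) (Ah D xi) (Ax D xi) (Ay D xi).
Proof.
split=> [c a||g h|g gL|h|h|||].
- exact: pscal_comm.
- by have := pres_rel (Axi_one D xi); rewrite pres_pi1.
- by have := pres_rel (Axi_mul D xi g h); rewrite pres_piM.
- exact: (pres_rel (Axi_Lambda xi gL)).
- exact: (pres_relM (Axi_hx D xi h)).
- exact: (pres_relM (Axi_hy D xi h)).
- by have := pres_rel (Axi_xr D xi); rewrite pres_piX.
- by have := pres_rel (Axi_ys D xi); rewrite pres_piX.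
- have := pres_rel (Axi_xy D xi).
  by rewrite pres_piM pres_piD !pres_piZ pres_piM pres_piD pres_piN pres_pi1.
Qed.

Variables (M : lmodType (Axi D xi)) (eta : fiber D xi).
Variables (rho : representation rel (W D)) (w : M).
Hypothesis rhoP : L_action eta rho.
Hypotheses (yw0 : Ay D xi *: w = 0)
  (hw : forall h, Ah D xi h *: w = (pscal rel (eta h) : Axi D xi) *: w).

Definition intertwiner (v : rep_module rho) : M :=
  @basis_map k (Axi D xi) (pscal rel) M r (fun i => Ax D xi ^+ i *: w) v.

(** By [presAlg_ind] it suffices to treat scalars and generators, and for generators to compare
    basis vectors. *)
Lemma intertwiner_act (a : Axi D xi) (v : W D) :
  intertwiner (rho a v) = a *: intertwiner v.
Proof.
have sc_comm := Axi_sc_comm Axi_relationsP.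
have [rhox rhoh rhoy] := rhoP.
elim/presAlg_ind: a v => [c|x|a b IHa IHb|a b IHa IHb] v.
- by rewrite ractC; apply: basis_mapZ.
- apply: (basis_map_comm sc_comm (T := rho (pgen rel x))) => i.
  case: x => [h|[]].
  + rewrite [LHS](congr1 intertwiner (rhoh h i)) [LHS]basis_mapZ basis_map_delta.
    exact/esym/(weight_Xn Axi_relationsP hw).
  + rewrite [LHS](congr1 intertwiner (rhoy i)) [LHS]basis_mapZ basis_map_delta.
    (* At index 0 the value c_0 = 0 matches y w = 0; elsewhere the predecessor does not wrap
       around. *)
    case: i => -[|i] lt_ir; first by rewrite /= rmorph0 scale0r scale1r yw0.
    rewrite [RHS](lower_XSn nu1 Axi_relationsP yw0 hw).
    by rewrite /= modnDr modn_small // ltnW.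
  + rewrite [LHS](congr1 intertwiner (rhox i)) [LHS]basis_map_delta.
    rewrite [RHS]scalerA -exprS.
    (* When f_(r-1) wraps around to f_0, the match comes from x^r = 1 on [M]. *)
    have [ir|ltir] := eqVneq i.+1 r.
      by rewrite /= ir modnn (Axi_Xr Axi_relationsP) alpha1 rmorph1.
    by rewrite /= modn_small // ltn_neqAle ltir ltn_ord.
- by rewrite ractDl [LHS]basis_mapD [RHS]scalerDl -IHa -IHb.
- by rewrite ractM IHa IHb; apply: scalerA.
Qed.

Lemma intertwiner_linear : linear intertwiner.
Proof.
by move=> a u v; rewrite [LHS]basis_mapD; congr (_ + _); apply: intertwiner_act.
Qed.

Lemma intertwiner_iso : w != 0 -> irreducible_module M ->
  module_iso M (rep_module rho).
Proof.
move=> w0 irrM.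
pose f : {linear rep_module rho -> M} :=
  HB.pack intertwiner
    (GRing.isLinear.Build _ _ _ _ intertwiner intertwiner_linear).
apply: (irreducible_module_iso (f := f)) (L_irreducible alpha1 rhoP) irrM _.
pose i0 : 'I_r := Ordinal (r_gt0 D).
exists (delta_mx 0 i0 : W D).
by rewrite [f _]basis_map_delta expr0 scale1r.
Qed.

End LiftingModules.

Theorem theorem3p6 (k : closedFieldType) (char0 : [pchar k] =i pred0)
    (gT : finGroupType) (abG : abelian [set: gT])
    (D : quantum_plane_datum k gT)
    (xi : gT -> k) (xiP : is_character (Lambda D) xi)
    (alpha1 : alpha D xi = 1) (nu1 : nu D = 1) (beta0 : beta D xi = 0) :
  (forall (eta : fiber D xi) (i : nat), (0 < i <= ord_r D)%N ->
     coef D eta i =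
       chi1 D (g1 D) * (coef D eta i.-1 + nu D
         - nu D * chi1 D (g1 D) ^+ (2 * i.-1) * eta (g1 D * g2 D)%g)) /\
  exists L : forall eta : fiber D xi, representation (Axi_rel D xi) (W D),
    [/\ forall eta : fiber D xi, L_action eta (L eta),
        forall eta : fiber D xi, irreducible_module (rep_module (L eta)),
        forall M : lmodType (Axi D xi), irreducible_module M ->
          exists eta : fiber D xi, module_iso M (rep_module (L eta))
      & forall eta eta' : fiber D xi,
          module_iso (rep_module (L eta)) (rep_module (L eta')) ->
          exists m : int, forall h : gT, eta h = eta' h * chi1 D h ^ m].
Proof.
split=> [eta [//|i] _ /=|].
  (* The value of [chi1] at g1 g2 is q^2, which turns its power i - 1 into the exponent 2(i - 1). *)
  rewrite chi1_g1g2 // -exprM; ring.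
have [L LP] : {L : forall eta : fiber D xi, representation (Axi_rel D xi) (W D)
    & forall eta : fiber D xi, L_action eta (L eta)}.
  apply: (boolp.choice (P := fun (eta : fiber D xi)
    (rho : representation (Axi_rel D xi) (W D)) => L_action eta rho)).
  exact: L_action_exists.
exists L; split=> [//|eta|M irrM|eta eta'].
- exact: L_irreducible.
- have [eta [w [w0 yw0 hw]]] :=
    weight_vector abG beta0 (Axi_relationsP D xi) irrM.
  by exists eta; apply: intertwiner_iso (LP eta) yw0 hw w0 irrM.
- exact: L_iso_weights.
Qed.
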